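(* Let $p\ge1$, $q\ge 0$, and let $r_1\le r_2\le\cdots\le r_{p+q}$ be nonnegative integers. For every integer $n\ge0$, $$B_n(z;\mathbf{r}_p)=\sum_{k=0}^{|\mathbf{r}_{p-1}|}a_k(\mathbf{r}_{p-1})\,B_{n+k}(z;r_p),$$ $$B_n(z;\mathbf{r}_{p+q})=\sum_{k=0}^{|\mathbf{r}_{p-1}|}a_k(\mathbf{r}_{p-1})\,B_{n+k}(z;r_p,\ldots,r_{p+q}).$$
   Context: For a vector $\mathbf{s}=(s_1,\ldots,s_m)$ of nonnegative integers with $s_1\le\cdots\le s_m$, write $|\mathbf{s}|=s_1+\cdots+s_m$, and $\mathbf{r}_j=(r_1,\ldots,r_j)$. Let $S_1=\{1,\ldots,s_1\}$, $S_2=\{s_1+1,\ldots,s_1+s_2\}$, ..., $S_m$ the next $s_m$ integers. The number ${N\brace k}_{\mathbf{s}}$ is the number of partitions of $\{1,\ldots,N\}$ into $k$ nonempty blocks such that, for each $i$, the elements of $S_i$ lie in pairwise distinct blocks; and $B_n(z;\mathbf{s})=\sum_{k=0}^{n+s_1+\cdots+s_{m-1}}{n+|\mathbf{s}|\brace k+s_m}_{\mathbf{s}}z^k$ (for $m=1$ this is the $r$-Bell polynomial $B_n(z;r)=\sum_{k=0}^n{n+r\brace k+r}_r z^k$). With $\genfrac{[}{]}{0pt}{}{n}{k}$ the unsigned Stirling numbers of the first kind, $$a_k(\mathbf{r}_{p-1})=(-1)^{|\mathbf{r}_{p-1}|-k}\sum_{j_1+\cdots+j_{p-1}=k}\genfrac{[}{]}{0pt}{}{r_1}{j_1}\cdots\genfrac{[}{]}{0pt}{}{r_{p-1}}{j_{p-1}},$$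 equivalently $\sum_k a_k(\mathbf{r}_{p-1})u^k=u^{\underline{r_1}}\cdots u^{\underline{r_{p-1}}}$ where $u^{\underline{r}}=u(u-1)\cdots(u-r+1)$. *)

(* Defs.v *)
From mathcomp Require Import all_boot all_order all_fingroup all_algebra.

Set Implicit Arguments.
Unset Strict Implicit.
Unset Printing Implicit Defensive.

Import GRing.Theory.

Local Open Scope ring_scope.

(* The ground set {1, ..., N} is 'I_N, the ordinal x standing for x + 1.      *)
(* Vectors are 0-indexed sequences: s_(i+1) is nth 0 s i, and |s| is sumn s.  *)

(* S_(i+1), for i < size s: the (i+1)-th of the consecutive runs of lengths   *)
(* s_1, s_2, ... that fill up {1, ..., |s|}.                                  *)
Definition segment (N : nat) (s : seq nat) (i : nat) : {set 'I_N} :=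
  [set x : 'I_N | (sumn (take i s) <= x < sumn (take i.+1 s))%N].

Definition separates (N : nat) (P : {set {set 'I_N}}) (A : {set 'I_N}) : bool :=
  [forall x in A, forall y in A, (x != y) ==> (pblock P x != pblock P y)].

(* The number written {N brace k}_s. *)
Definition stirling2 (s : seq nat) (N k : nat) : nat :=
  #|[set P : {set {set 'I_N}} |
      [&& partition P [set: 'I_N], #|P| == k
        & [forall i : 'I_(size s), separates P (segment N s i)]]]|.

(* B_n(z; s) for nonempty s, as a polynomial in the indeterminate z = 'X; the *)
(* range of k is 0, ..., n + s_1 + ... + s_(m-1), where m = size s.           *)
Definition bell (n : nat) (s : seq nat) : {poly int} :=
  \sum_(k < (n + sumn (take (size s).-1 s)).+1)
    (stirling2 s (n + sumn s) (k + last 0%N s))%:R *: 'X^k.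

(* Unsigned Stirling numbers of the first kind: permutations of n points with *)
(* k cycles, fixed points included.                                           *)
Definition stirling1 (n k : nat) : nat :=
  #|[set u : 'S_n | #|porbits u| == k]|.

(* The parts j_i of a sum equal to k are at most k, so that they can be taken *)
(* in 'I_k.+1. The truncated subtraction in the sign is exact for k <= |s|,   *)
(* and the sum is 0 for larger k.                                             *)
Definition acoef (s : seq nat) (k : nat) : int :=
  (-1) ^+ (sumn s - k) *
  \sum_(j : {ffun 'I_(size s) -> 'I_k.+1} | (\sum_i j i == k)%N)
    \prod_(i < size s) (stirling1 (nth 0%N s i) (j i))%:R.

(* Main.v *)
(* The maps {1, ..., N} -> {1, ..., x} that are injective on every S_i number     *)
(* x^(N - |s|) * prod_i x^_(s_i); sorting them by kernel, a partition separating  *)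
(* every S_i, this is also sum_k {N brace k}_s x^_k. Hence the numbers            *)
(* {N brace k}_s are the coordinates of that polynomial in the basis of falling   *)
(* factorials. Expanding the product over the first p - 1 entries of s in powers  *)
(* of x, with coefficients a_k, turns it into a combination of the polynomials    *)
(* that belong to the remaining entries and to n + k in place of n; comparing     *)
(* coordinates gives both identities.                                             *)

Require Import Defs.
From mathcomp Require Import all_boot all_order all_fingroup all_algebra.

Set Implicit Arguments.
Unset Strict Implicit.
Unset Printing Implicit Defensive.

Import GRing.Theory.

Local Open Scope ring_scope.

(** Both identities are instances of [bell_cat], for a vector split as [s ++ t]. By
    [card_segment_injective] and [sum_stirling2], the numbers [stirling2 (s ++ t) N h] are the
    falling factorial coordinates of x^n times the falling factorials of x at the entries of [s] and
    [t]. By [sum_acoef] the factors from [s] equal the sum of a_k x^k, and each x^k only moves n to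
    n + k in the polynomial of [t]. Equality at all natural x gives equality of coordinates, by
    [ffact_coef_inj]. *)

(** * Counting maps with a prescribed kernel *)

(** Makes the image of [h] a type, so that a map constant on the fibres of [h] is a pullback from
    that type. *)
Lemma imset_surjection (T U : finType) (h : T -> U) :
  exists2 V : finType, #|V| = #|[set h x | x : T]|
    & exists2 h' : T -> V, (forall v, exists x, h' x = v)
        & forall x y, (h' x == h' y) = (h x == h y).
Proof.
have hV x : h x \in [set h x | x : T] by apply: imset_f.
exists {u : U | u \in [set h x | x : T]}; first by rewrite card_sig.
exists (fun x => exist _ (h x) (hV x)) => [[u uP] | x y];
  last by rewrite -(inj_eq val_inj).
by case/imsetP: (uP) => x _ def_u; exists x; apply: val_inj.
Qed.

Definition pullback (T V X : finType) (h : T -> V) (g : {ffun V -> X}) : {ffun T -> X} :=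
  [ffun x => g (h x)].

Section Pullback.

Variables (T V X : finType) (h : T -> V).
Hypothesis h_surj : forall v, exists x, h x = v.

Lemma pullback_inj : injective (@pullback T V X h).
Proof.
move=> g1 g2 /ffunP eqg; apply/ffunP=> v.
by have [x <-] := h_surj v; have := eqg x; rewrite !ffunE.
Qed.

Lemma pullback_surj (f : {ffun T -> X}) :
  (forall x y, h x = h y -> f x = f y) -> exists g, f = pullback h g.
Proof.
move=> f_const; have hK v : {x | h x == v}.
  by apply: sigW; have [x <-] := h_surj v; exists x.
exists [ffun v => f (sval (hK v))]; apply/ffunP=> x; rewrite !ffunE.
by apply: f_const; case: (hK _) => y /= /eqP.
Qed.

End Pullback.

Lemma card_ffun_factor (T U X : finType) (h : T -> U) :
  #|[set f : {ffun T -> X} | [forall x, forall y, (h x == h y) ==> (f x == f y)]]|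
    = (#|X| ^ #|[set h x | x : T]|)%N.
Proof.
have [V <- [h' h'_surj h'E]] := imset_surjection h.
rewrite -card_ffun -cardsT -(card_imset _ (pullback_inj (X := X) h'_surj)).
apply: eq_card => f; rewrite inE; apply/'forall_forallP/imsetP => [factf | [g _ ->] x y].
  have [|g ->] := pullback_surj h'_surj (f := f); last by exists g.
  by move=> x y /eqP; rewrite h'E => hxy; apply/eqP/(implyP (factf x y)).
by rewrite -h'E !ffunE; apply/implyP=> /eqP->.
Qed.

(** Having exactly the kernel of [h] means being the pullback of an injective map on the image of
    [h]. *)
Lemma card_ffun_kernel (T U X : finType) (h : T -> U) :
  #|[set f : {ffun T -> X} | [forall x, forall y, (f x == f y) == (h x == h y)]]|
    = (#|X| ^_ #|[set h x | x : T]|)%N.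
Proof.
have [V <- [h' h'_surj h'E]] := imset_surjection h.
rewrite -card_inj_ffuns -(card_imset _ (pullback_inj h'_surj)).
apply: eq_card => f; rewrite inE; apply/'forall_forallP/imsetP => [kerf | [g]].
  have [|g def_f] := pullback_surj h'_surj (f := f).
    by move=> x y /eqP; rewrite h'E -(eqP (kerf x y)) => /eqP.
  exists g => //; rewrite inE; apply/injectiveP=> u v.
  have [[x <-] [y <-]] := (h'_surj u, h'_surj v) => /eqP gxy; apply/eqP.
  by rewrite h'E -(eqP (kerf x y)) def_f !ffunE.
by rewrite inE => /injectiveP g_inj -> x y; rewrite !ffunE (inj_eq g_inj) h'E.
Qed.

(** * Stirling numbers of the first kind and the coefficients a_k *)

(* x ^ #|porbits u| counts the f : 'I_n -> 'I_x with f \o u = f, and the signed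
   count of the u fixing a given f is the determinant of the matrix of f i = f j. *)
Lemma sum_sign_porbits (n x : nat) :
  \sum_(u : 'S_n) (-1) ^+ u * (x ^ #|porbits u|)%:R = (x ^_ n)%:R :> int.
Proof.
pose M (f : {ffun 'I_n -> 'I_x}) : 'M[int]_n := \matrix_(i, j) (f i == f j)%:R.
have detM f : \det (M f) = (injectiveb f)%:R.
  case: injectiveP => [f_inj | /injectiveP/injectivePn[i [j neq_ij eqf]]].
    rewrite -(det1 _ n); congr (\det _); apply/matrixP=> i j.
    by rewrite !mxE (inj_eq f_inj).
  by rewrite (determinant_alternate neq_ij) // => k; rewrite !mxE eqf.
have <- : #|[set f : {ffun 'I_n -> 'I_x} | injectiveb f]| = (x ^_ n)%N.
  by rewrite card_inj_ffuns !card_ord.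
rewrite -sum1_card natr_sum [RHS]big_mkcond /=.
transitivity (\sum_(f : {ffun 'I_n -> 'I_x}) \det (M f)); last first.
  by apply: eq_bigr => f _; rewrite detM inE; case: injectiveb.
rewrite /determinant exchange_big /=; apply: eq_bigr => u _.
rewrite -big_distrr /=; congr (_ * _).
have -> : (x ^ #|porbits u|)%N =
    #|[set f : {ffun 'I_n -> 'I_x} | [forall i, f i == f (u i)]]|.
  rewrite -[x in LHS]card_ord -card_ffun_factor; apply: eq_card => f; rewrite !inE.
  apply/'forall_forallP/'forall_eqP=> [factf i | fixf i j].
    by apply/eqP/(implyP (factf i (u i))); have := porbit_perm u 1 i; rewrite expg1 => ->.
  rewrite eq_porbit_mem porbit_sym; apply/implyP=> /porbitP[k ->]; apply/eqP.
  by elim: k => [|k IHk]; rewrite ?perm1 // expgSr permM -fixf.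
rewrite -sum1_card natr_sum [LHS]big_mkcond /=; apply: eq_bigr => f _; rewrite inE.
case: (boolP [forall i, f i == f (u i)]) => [/forallP fixf | /forallPn[i /negPf fixi]].
  by rewrite big1 // => i _; rewrite mxE fixf.
by rewrite (bigD1 i) //= mxE fixi mul0r.
Qed.

Lemma card_porbits_le (n : nat) (u : 'S_n) : (#|porbits u| <= n)%N.
Proof. by rewrite (leq_trans (leq_imset_card _ _)) // card_ord. Qed.

Lemma stirling1_small (n k : nat) : (n < k)%N -> stirling1 n k = 0%N.
Proof.
move=> lt_nk; apply/eqP; rewrite cards_eq0; apply/eqP/setP=> u; rewrite !inE.
by apply: contraTF lt_nk => /eqP <-; rewrite -leqNgt card_porbits_le.
Qed.

(** Permutations are grouped by their number k of cycles; the sign has the parity of n + k. The free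
    bound [m] lets factors with different n share one range. *)
Lemma sum_stirling1 (n m x : nat) : (n <= m)%N ->
  \sum_(k < m.+1) (-1) ^+ (n + k) * (stirling1 n k)%:R * x%:R ^+ k
    = (x ^_ n)%:R :> int.
Proof.
move=> le_nm; rewrite -sum_sign_porbits.
rewrite (partition_big (fun u => inord #|porbits u| : 'I_m.+1) predT) //=.
apply: eq_bigr => k _; rewrite /stirling1 -sum1_card natr_sum big_distrr big_distrl /=.
apply: eq_big => [u | u]; rewrite inE; last move/eqP=> def_k.
  by rewrite -(inj_eq val_inj) /= inordK // ltnS (leq_trans (card_porbits_le u)).
by rewrite mulr1 /odd_perm signr_addb !signr_odd card_ord def_k exprD natrX.
Qed.

(** Expanding a product of sums gives index functions with a bound independent of k; parts of a sum
    k are at most k, so nothing is added. *)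
Lemma acoef_widen (s : seq nat) (m k : nat) : (k <= m)%N ->
  acoef s k = (-1) ^+ (sumn s - k) *
    \sum_(j : {ffun 'I_(size s) -> 'I_m.+1} | (\sum_i j i == k)%N)
      \prod_(i < size s) (stirling1 (nth 0%N s i) (j i))%:R.
Proof.
move=> le_km; congr (_ * _).
have le_km1 : (k.+1 <= m.+1)%N by [].
pose wid (j : {ffun 'I_(size s) -> 'I_k.+1}) := [ffun i => widen_ord le_km1 (j i)].
pose nar (j : {ffun 'I_(size s) -> 'I_m.+1}) : {ffun 'I_(size s) -> 'I_k.+1} :=
  [ffun i => inord (j i)].
rewrite [RHS](reindex_onto wid nar) /= => [|j /eqP sum_j]; last first.
  apply/ffunP=> i; rewrite !ffunE; apply: val_inj; rewrite /= inordK // ltnS.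
  by rewrite -sum_j (bigD1 i) //= leq_addr.
apply: eq_big => [j | j _]; last by apply: eq_bigr => i _; rewrite ffunE.
under [in RHS]eq_bigr do rewrite ffunE /=.
case: eqP => // _; apply/esym/eqP/ffunP=> i; rewrite !ffunE.
by apply: val_inj; rewrite /= inordK.
Qed.

Lemma leq_nth_sumn (s : seq nat) (i : nat) : (nth 0 s i <= sumn s)%N.
Proof.
elim: s i => [|a s IHs] [|i] //=; first exact: leq_addr.
by rewrite (leq_trans (IHs i)) ?leq_addl.
Qed.

Lemma sum_acoef (s : seq nat) (x : nat) :
  \sum_(k < (sumn s).+1) acoef s k * x%:R ^+ k = \prod_(a <- s) (x ^_ a)%:R.
Proof.
have [m def_m] : {m | m = sumn s} by exists (sumn s).
have m_sum : m = (\sum_(i < size s) nth 0 s i)%N.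
  by rewrite def_m sumnE (big_nth 0%N) big_mkord.
have le_m i : (nth 0 s i <= m)%N by rewrite def_m leq_nth_sumn.
rewrite -def_m (big_nth 0%N) big_mkord.
under [RHS]eq_bigr do rewrite -(sum_stirling1 _ (le_m _)).
rewrite bigA_distr_bigA /=.
rewrite [RHS](bigID (fun j : {ffun 'I_(size s) -> 'I_m.+1} =>
  \sum_i j i < m.+1)%N) /=.
(* If the parts sum to more than |s|, some part exceeds its entry of [s], and that Stirling number
   is 0. *)
rewrite [X in _ = _ + X]big1 ?addr0 => [|j]; last first.
  rewrite -leqNgt => lt_sum.
  have [i lt_i] : exists i : 'I_(size s), (nth 0 s i < j i)%N.
    apply/existsP; apply: contraLR lt_sum => /existsPn le_j; rewrite -leqNgt [leqRHS]m_sum.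
    by apply: leq_sum => i _; rewrite leqNgt le_j.
  by rewrite (bigD1 i) //= stirling1_small // mulr0 !mul0r.
rewrite [RHS](partition_big (fun j : {ffun 'I_(size s) -> 'I_m.+1} =>
  inord (\sum_i j i) : 'I_m.+1) predT) //=.
apply: eq_bigr => k _; rewrite (@acoef_widen _ m) -1?ltnS // mulrAC big_distrr /=.
apply: eq_big => [j | j /eqP sum_j].
  apply/eqP/andP=> [-> | [lt_j /eqP/(congr1 val)]]; last by rewrite /= inordK.
  by split=> //; apply/eqP/val_inj; rewrite /= inordK.
(* The signs multiply to (-1)^(|s| + k), which has the parity of |s| - k. *)
rewrite !big_split /= !prodrXr big_split -m_sum -def_m sum_j mulrAC.
by rewrite -signr_odd oddB -1?ltnS // -oddD signr_odd.
Qed.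

(** * Maps injective on every segment *)

Lemma segmentS (a N : nat) (s : seq nat) (i : nat) :
  segment (a + N) (a :: s) i.+1 = [set rshift a x | x in segment N s i].
Proof.
apply/setP=> x; rewrite inE /=; case: (split_ordP x) => y ->.
  rewrite [LHS]negbTE; last by rewrite negb_and -ltnNge (leq_trans (ltn_ord y)) ?leq_addr.
  by apply/esym/imsetP=> [[z _ /eqP]]; rewrite eq_lrshift.
by rewrite leq_add2l ltn_add2l mem_imset ?inE //; apply: rshift_inj.
Qed.

Lemma segment0 (a N : nat) (s : seq nat) :
  segment (a + N) (a :: s) 0 = [set lshift N x | x : 'I_a].
Proof.
apply/setP=> x; rewrite inE /= take0 addn0; case: (split_ordP x) => y -> /=.
  by rewrite imset_f.
by apply/esym/imsetP=> [[z _ /eqP]]; rewrite eq_rlshift.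
Qed.

Definition segment_injective (X : finType) (N : nat) (s : seq nat) (f : 'I_N -> X) : bool :=
  [forall i : 'I_(size s), dinjectiveb f (segment N s i)].

Definition glue (X : finType) (a N : nat) (gf : {ffun 'I_a -> X} * {ffun 'I_N -> X}) :
    {ffun 'I_(a + N) -> X} :=
  [ffun x => match split x with inl y => gf.1 y | inr y => gf.2 y end].

Lemma glue_lshift (X : finType) a N gf (x : 'I_a) : @glue X a N gf (lshift N x) = gf.1 x.
Proof. by rewrite ffunE; have /= -> := unsplitK (inl x : 'I_a + 'I_N). Qed.

Lemma glue_rshift (X : finType) a N gf (x : 'I_N) : @glue X a N gf (rshift a x) = gf.2 x.
Proof. by rewrite ffunE; have /= -> := unsplitK (inr x : 'I_a + 'I_N). Qed.

Lemma glue_inj (X : finType) a N : injective (@glue X a N).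
Proof.
move=> [g1 g2] [h1 h2] /ffunP eq_gh; congr (_, _); apply/ffunP=> x.
  by have := eq_gh (lshift N x); rewrite !glue_lshift.
by have := eq_gh (rshift a x); rewrite !glue_rshift.
Qed.

Lemma glue_surj (X : finType) a N f : exists gf, f = @glue X a N gf.
Proof.
exists ([ffun x => f (lshift N x)], [ffun x => f (rshift a x)]).
by apply/ffunP=> x; case: (split_ordP x) => y ->; rewrite ?glue_lshift ?glue_rshift ffunE.
Qed.

Lemma segment_injective_glue (X : finType) a N s gf :
  segment_injective (a :: s) (@glue X a N gf)
    = injectiveb gf.1 && segment_injective s gf.2.
Proof.
apply/forallP/andP=> [inj_gf | [/injectiveP g_inj /forallP f_inj] i].
  split.
    apply/injectiveP=> x y eq_xy; apply: (@lshift_inj _ N).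
    have /dinjectiveP := inj_gf ord0; apply; rewrite ?segment0 ?imset_f //.
    by rewrite !glue_lshift.
  apply/forallP=> i; apply/dinjectiveP=> x y xS yS eq_xy; apply: (@rshift_inj a).
  have /dinjectiveP := inj_gf (lift ord0 i); apply; rewrite ?segmentS ?imset_f //.
  by rewrite !glue_rshift.
apply/dinjectiveP; case: (unliftP ord0 i) => [i' |] ->.
  rewrite lift0 segmentS => _ _ /imsetP[x xS ->] /imsetP[y yS ->].
  by rewrite !glue_rshift => eq_xy; congr rshift; apply: (dinjectiveP _ _ (f_inj i')).
rewrite segment0 => _ _ /imsetP[x _ ->] /imsetP[y _ ->].
by rewrite !glue_lshift => /g_inj->.
Qed.

(** By induction on [s]: the first segment carries an injective map chosen independently of the
    rest, and points beyond the last segment are free. *)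
Lemma card_segment_injective (X : finType) (N : nat) (s : seq nat) : (sumn s <= N)%N ->
  #|[set f : {ffun 'I_N -> X} | segment_injective s f]|
    = (#|X| ^ (N - sumn s) * \prod_(a <- s) #|X| ^_ a)%N.
Proof.
elim: s N => [|a s IHs] N /= => [_ | le_aN].
  rewrite big_nil muln1 subn0 -[N in RHS]card_ord -card_ffun -cardsT.
  by apply: eq_card => f; rewrite !inE; apply/forallP=> [[]].
have [N' def_N] : {N' | N = a + N'}%N.
  by exists (N - a)%N; rewrite subnKC // (leq_trans _ le_aN) ?leq_addr.
move: le_aN; rewrite {N}def_N leq_add2l subnDl => le_sN.
rewrite big_cons mulnCA -(IHs _ le_sN) -[a in RHS]card_ord -card_inj_ffuns -cardsX.
rewrite -(card_imset _ (@glue_inj X a N')); apply: eq_card => f; rewrite inE.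
have [gf ->] := glue_surj f.
by rewrite (mem_imset _ _ (@glue_inj X a N')) !inE segment_injective_glue.
Qed.

(** * Partitions as kernels of maps *)

Lemma imset_pblock (T : finType) (P : {set {set T}}) :
  partition P setT -> [set pblock P x | x : T] = P.
Proof.
move=> partP; have [/eqP covP trivP nP0] := and3P partP.
apply/setP=> B; apply/imsetP/idP=> [[x _ ->] | PB]; first by rewrite pblock_mem ?covP.
have [x Bx] : exists x, x \in B by apply/set0Pn; apply: contraNneq nP0 => <-.
by exists x => //; rewrite (def_pblock trivP PB Bx).
Qed.

Lemma preim_partition_eq (T U : finType) (f : T -> U) (P : {set {set T}}) :
  partition P setT ->
  (preim_partition f setT == P)
    = [forall x, forall y, (f x == f y) == (pblock P x == pblock P y)].
Proof.
move=> partP; have [/eqP covP trivP _] := and3P partP.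
apply/eqP/'forall_forallP=> [<- x y | kerf].
  have /and3P[/eqP covf trivf _] := preim_partitionP f setT.
  rewrite [X in _ == X]eq_pblock ?covf // pblock_equivalence_partition //.
  by move=> u v w _ _ _; split=> // /eqP->.
rewrite -[RHS](equivalence_partition_pblock partP).
apply: eq_imset => x; apply/setP=> y; rewrite !inE (eqP (kerf x y)) eq_pblock ?covP //.
Qed.

Lemma separatesE (N : nat) (P : {set {set 'I_N}}) (A : {set 'I_N}) :
  separates P A = dinjectiveb (pblock P) A.
Proof.
apply/'forall_in_forall_inP/dinjectiveP=> [sepP x y Ax Ay /eqP | inj x Ax y Ay].
  by apply: contraTeq; apply: implyP; apply: sepP.
by apply/implyP; apply: contra_neq; apply: inj.
Qed.

(** A map is injective on each segment exactly when its kernel separates it, and a partition P is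
    the kernel of [x ^_ #|P|] maps. The bound [m] lets different N share one range. *)
Lemma sum_stirling2 (s : seq nat) (N m x : nat) : (sumn s <= N <= m)%N ->
  (\sum_(k < m.+1) stirling2 s N k * x ^_ k
    = x ^ (N - sumn s) * \prod_(a <- s) x ^_ a)%N.
Proof.
case/andP=> le_sN le_Nm; rewrite -[x in RHS]card_ord -card_segment_injective //.
pose ker (f : {ffun 'I_N -> 'I_x}) := preim_partition f setT.
pose Q (P : {set {set 'I_N}}) :=
  partition P setT && [forall i : 'I_(size s), separates P (segment N s i)].
have kerE P f : partition P setT -> ker f = P ->
    forall u v, (f u == f v) = (pblock P u == pblock P v).
  move=> partP /eqP; rewrite preim_partition_eq // => /'forall_forallP kerf u v.
  exact: eqP (kerf u v).
have inj_ker P f : partition P setT -> ker f == P ->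
    segment_injective s f = [forall i : 'I_(size s), separates P (segment N s i)].
  move=> partP /eqP/(kerE _ _ partP) fE; apply: eq_forallb => i; rewrite separatesE.
  apply/dinjectiveP/dinjectiveP=> inj u v Au Av /eqP eq_uv; apply: inj => //.
    by apply/eqP; rewrite fE.
  by apply/eqP; rewrite -fE.
have fiber P : partition P setT -> #|[set f | ker f == P]| = (x ^_ #|P|)%N.
  move=> partP; rewrite -[x in RHS]card_ord -[in RHS](imset_pblock partP) -card_ffun_kernel.
  by apply: eq_card => f; rewrite !inE preim_partition_eq.
rewrite -[RHS]sum1_card (partition_big ker Q) => [|f]; last first.
  by rewrite inE /Q preim_partitionP (@inj_ker (ker f)) ?preim_partitionP.
transitivity (\sum_(P | Q P) x ^_ #|P|)%N; last first.
  apply: eq_bigr => P /andP[partP sepP]; rewrite -fiber // -sum1_card.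
  apply: eq_bigl => f; rewrite !inE; case: eqP => [/eqP def_P|]; rewrite ?andbF // andbT.
  by rewrite (inj_ker P).
(* Here [inord] loses nothing, since a partition has at most N <= m blocks. *)
rewrite (partition_big (fun P : {set {set 'I_N}} => inord #|P| : 'I_m.+1) predT) //=.
apply: eq_bigr => k _; rewrite /stirling2 -sum1_card big_distrl /=.
have cardP P : partition P [set: 'I_N] -> (#|P| <= m)%N.
  move=> partP; rewrite (leq_trans _ le_Nm) // -(imset_pblock partP).
  by rewrite (leq_trans (leq_imset_card _ _)) // card_ord.
apply: eq_big => [P | P]; rewrite inE; last by case/and3P=> _ /eqP-> _; rewrite mul1n.
rewrite /Q; case: (boolP (partition P setT)) => //= partP; rewrite andbC.
by rewrite -(inj_eq val_inj) /= inordK // ltnS cardP.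
Qed.

Lemma stirling2_small (s : seq nat) (N k : nat) : (N < k)%N -> stirling2 s N k = 0%N.
Proof.
move=> lt_Nk; apply/eqP; rewrite cards_eq0; apply/eqP/setP=> P; rewrite !inE.
apply: contraTF lt_Nk => /and3P[partP /eqP<- _]; rewrite -leqNgt -(imset_pblock partP).
by rewrite (leq_trans (leq_imset_card _ _)) // card_ord.
Qed.

(** * Comparison of coordinates *)

(** Beyond the range of the sum in [bell], more blocks than points are asked for, so the formula
    holds for every i. *)
Lemma coef_bell (n : nat) (s : seq nat) (i : nat) : (0 < size s)%N ->
  (bell n s)`_i = (stirling2 s (n + sumn s) (i + last 0%N s))%:R.
Proof.
case/lastP: s => // s a _; rewrite /bell last_rcons size_rcons /= -cats1 take_size_cat //.
rewrite sumn_cat /= addn0 addnA -(poly_def _ (fun k => (stirling2 _ _ (k + a))%:R)) coef_poly.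
case: leqP => // lt_i; rewrite stirling2_small // ltn_add2r //.
Qed.

(** Triangularity: at x = k the terms above k vanish, those below vanish by induction, and k! is
    nonzero. *)
Lemma ffact_coef_inj (R : numDomainType) (m : nat) (d : nat -> R) :
  (forall x, \sum_(k < m) d k * (x ^_ k)%:R = 0) -> forall k, (k < m)%N -> d k = 0.
Proof.
move=> d0 k; have [i] := ubnP k; elim: i k => // i IHi k /ltnSE le_ki lt_km.
have := d0 k; rewrite (bigD1 (Ordinal lt_km)) //= big1 ?addr0 => [/eqP | j neq_jk].
  by rewrite ffactnn mulf_eq0 Num.Theory.pnatr_eq0 eqn0Ngt fact_gt0 orbF => /eqP.
case: (ltngtP j k) => [lt_jk | lt_kj | eq_jk].
- by rewrite IHi ?mul0r // (leq_trans lt_jk).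
- by rewrite ffact_small ?mulr0.
- by case/eqP: neq_jk; apply: val_inj.
Qed.

Lemma bell_cat (n : nat) (s t : seq nat) : (0 < size t)%N ->
  bell n (s ++ t) = \sum_(k < (sumn s).+1) acoef s k *: bell (n + k) t.
Proof.
move=> t_gt0; have st_gt0 : (0 < size (s ++ t))%N by rewrite size_cat ltn_addl.
have last_st : last 0%N (s ++ t) = last 0%N t.
  by case: t t_gt0 {st_gt0} => // a t _; rewrite last_cat.
apply/polyP=> i; rewrite coef_bell // last_st coef_sum.
under eq_bigr do rewrite coefZ coef_bell //.
set N := (n + sumn (s ++ t))%N; set j := (i + _)%N.
have le_N (k : 'I_(sumn s).+1) : (n + k + sumn t <= N)%N.
  by rewrite /N sumn_cat addnA leq_add2r leq_add2l -ltnS.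
have [le_jN | lt_Nj] := leqP j N; last first.
  rewrite stirling2_small // big1 // => k _.
  by rewrite stirling2_small ?mulr0 // (leq_ltn_trans (le_N k)).
apply/eqP; rewrite -subr_eq0; apply/eqP.
(* The coordinate differences must be considered for all h <= N at once, although only h = j is
   wanted. *)
pose d h : int := (stirling2 (s ++ t) N h)%:R
  - \sum_(k < (sumn s).+1) acoef s k * (stirling2 t (n + k + sumn t) h)%:R.
rewrite -/(d j); apply: (@ffact_coef_inj _ N.+1) => // x.
under eq_bigr do rewrite mulrBl mulr_suml.
rewrite sumrB exchange_big /=.
under eq_bigr do rewrite -natrM.
rewrite -natr_sum sum_stirling2 ?leqnn ?leq_addl //.
rewrite (eq_bigr (fun k : 'I_(sumn s).+1 =>
    acoef s k * x%:R ^+ k * (x ^ n * \prod_(a <- t) x ^_ a)%N%:R)).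
  rewrite -mulr_suml sum_acoef -natr_prod -natrM addnK.
  by rewrite big_cat /= mulnCA subrr.
move=> k _; under eq_bigr do rewrite -mulrA -natrM.
rewrite -mulr_sumr -natr_sum sum_stirling2 ?leq_addl ?le_N //.
by rewrite addnK expnD -mulnA mulnCA natrM natrX mulrA.
Qed.

Theorem theorem4 (p q : nat) (r : (p + q).-tuple nat)
    (hp : (1 <= p)%N) (hr : sorted leq r) (n : nat) :
  bell n (take p r)
    = \sum_(k < (sumn (take p.-1 r)).+1)
        acoef (take p.-1 r) k *: bell (n + k) [:: nth 0%N r p.-1]
  /\
  bell n r
    = \sum_(k < (sumn (take p.-1 r)).+1)
        acoef (take p.-1 r) k *: bell (n + k) (drop p.-1 r).
Proof.
have lt_pr : (p.-1 < size r)%N by rewrite size_tuple prednK // leq_addr.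
(* In both cases [s] is the first p - 1 entries; [t] is all the remaining ones, or r_p alone. *)
split; last by rewrite -{1}(cat_take_drop p.-1 r) bell_cat // size_drop subn_gt0.
by rewrite -{1}(prednK hp) (take_nth 0%N) // -cats1 bell_cat.
Qed.
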